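(* For $(x,y)\in\mathbb{Z}^2$ and $s,t\in\{1,\dots,8\}$ let $\langle 0,0,s|\mathcal{K}^{-1}|x,y,t\rangle$ denote the limiting inverse Kasteleyn matrix elements of the square-octagon lattice (defined in the context). For every $\varepsilon>0$ there is a constant $C$ such that for all $(x,y)\in\mathbb{Z}^2$ and all $s,t\in\{1,\dots,8\}$, $$|\langle 0,0,s|\mathcal{K}^{-1}|x,y,t\rangle|\le C\Big(\frac{3-\sqrt5}{2}\Big)^{\max(|x|,|y|)(1-\varepsilon)} .$$ Consequently, in the infinite-size limit, the dimer-dimer connected correlator decays exponentially: let $e_0,e_1,e_2,\dots$ be edges of the infinite square-octagon lattice along a path which crosses two edges per fundamental cell, in the sense that there is a constant $c$ such that, for every $\ell$, the cell displacement $(x,y)$ between any endpoint of $e_0$ and any endpoint of $e_\ell$ satisfies $\max(|x|,|y|)\ge \ell/2-c$. Then the correlation length with respect to the edge distance $\ell$ is at most $\xi_0=\big(-\log\frac{3-\sqrt5}{2}\big)^{-1}=1.039043\ldots$, i.e. $$\limsup_{\ell\to\infty}\frac1\ell\log|C^d_{e_0e_\ell}|\le -\frac{1}{\xi_0}=\log\Big(\frac{3-\sqrt5}{2}\Big).$$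
   Context: The infinite square-octagon lattice has vertices $(x,y,t)$ with $(x,y)\in\mathbb{Z}^2$ (the fundamental cell) and $t\in\{1,\dots,8\}$; black vertices are $t\in\{1,2,3,4\}$ and white vertices are $t\in\{5,6,7,8\}$. Its edges are, for each $(x,y)$: $\{(x,y,5),(x,y,1)\}$, $\{(x,y,6),(x,y,2)\}$, $\{(x,y,7),(x,y,3)\}$, $\{(x,y,4),(x,y,8)\}$, $\{(x,y,7),(x+1,y,1)\}$, $\{(x,y,3),(x+1,y,5)\}$, $\{(x,y,2),(x,y+1,8)\}$, $\{(x,y,4),(x,y-1,6)\}$, $\{(x,y,1),(x,y,6)\}$, $\{(x,y,2),(x,y,7)\}$, $\{(x,y,3),(x,y,8)\}$, $\{(x,y,4),(x,y,5)\}$. The torus graph $G_n$ is the same with $(x,y)\in(\mathbb{Z}/n\mathbb{Z})^2$. Limiting inverse Kasteleyn matrix: $\langle 0,0,s|\mathcal{K}^{-1}|x,y,t\rangle=0$ if $s,t$ have the same color, and otherwise $$\langle 0,0,s|\mathcal{K}^{-1}|x,y,t\rangle=\int_0^{2\pi}\!\!\int_0^{2\pi}\frac{Q_{st}(e^{ik_x},e^{ik_y})\,e^{-i(k_xx+k_yy)}}{-5+2\cos k_x+2\cos k_y}\,\frac{dk_x}{2\pi}\frac{dk_y}{2\pi},$$ where for $s\in\{5,6,7,8\}$, $t\in\{1,2,3,4\}$, $Q_{st}(z,w)$ is: row $s=5$: $Q_{51}=2-w^{-1}$, $Q_{52}=1-z^{-1}w^{-1}$, $Q_{53}=1-2z^{-1}$,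 $Q_{54}=-z^{-1}-w+1$; row $s=6$: $Q_{61}=z+w-1$, $Q_{62}=2-z^{-1}$, $Q_{63}=1-wz^{-1}$, $Q_{64}=1-2w$; row $s=7$: $Q_{71}=2z-1$, $Q_{72}=z+w^{-1}-1$, $Q_{73}=2-w$, $Q_{74}=1-zw$; row $s=8$: $Q_{81}=1-zw^{-1}$, $Q_{82}=1-2w^{-1}$, $Q_{83}=-z^{-1}-w^{-1}+1$, $Q_{84}=z-2$; and $Q_{ts}(z,w)=-Q_{st}(z^{-1},w^{-1})$ for such $s,t$. The matrix is translation invariant: $\langle x_1,y_1,s|\mathcal{K}^{-1}|x_2,y_2,t\rangle=\langle 0,0,s|\mathcal{K}^{-1}|x_2-x_1,y_2-y_1,t\rangle$. Dimer-dimer connected correlator: a dimer covering is a perfect matching; for an edge $\mu$, $d_\mu=1$ if $\mu$ is occupied by a dimer and $0$ otherwise. $C^d_{\mu\nu}=\langle d_\mu d_\nu\rangle-\langle d_\mu\rangle\langle d_\nu\rangle$, where the averages are the $n\to\infty$ limits of averages over uniformly random dimer coverings of $G_n$. For edges $\mu=(b_1,w_1)$, $\nu=(b_2,w_2)$ ($b_i$ black, $w_i$ white) one has $|C^d_{\mu\nu}|=|\mathcal{K}^{-1}(w_2,b_1)\,\mathcal{K}^{-1}(w_1,b_2)|$. Convention: $\log 0=-\infty$. *)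

(* Defs.v *)
From mathcomp Require Import all_boot all_order all_algebra.
From mathcomp Require Import all_classical all_reals all_analysis.
From mathcomp Require Import complex.

Set Implicit Arguments.
Unset Strict Implicit.
Unset Printing Implicit Defensive.

Import Order.TTheory GRing.Theory Num.Theory.
Import numFieldNormedType.Exports.

Local Open Scope ring_scope.

(* Vertices of the square-octagon lattice whose cells are indexed by Z * Z:
   Z := int is the infinite lattice, Z := 'Z_m the m x m torus (2 <= m). The
   index i : 'I_8 stands for the vertex type t = i + 1 of {1, ..., 8}. *)
Definition vertex (Z : Type) : Type := (Z * Z * 'I_8)%type.

Definition vtype (i : 'I_8) : nat := i.+1.

Definition black (i : 'I_8) : bool := (vtype i <= 4)%N.

Definition edge (Z : Type) : Type := (vertex Z * vertex Z)%type.

(* An edge is the pair (black end, white end). In each case (x, y) is the cell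
   of the black end and (x', y') that of the white end. *)
Definition is_edge (Z : comPzRingType) (e : edge Z) : bool :=
  let: ((x, y, s), (x', y', t)) := e in
  match vtype s, vtype t with
  | 1%N, 5%N | 2%N, 6%N | 3%N, 7%N | 4%N, 8%N
  | 1%N, 6%N | 2%N, 7%N | 3%N, 8%N | 4%N, 5%N => (x' == x) && (y' == y)
  | 1%N, 7%N => (x == x' + 1) && (y' == y)
  | 3%N, 5%N => (x' == x + 1) && (y' == y)
  | 2%N, 8%N => (x' == x) && (y' == y + 1)
  | 4%N, 6%N => (x' == x) && (y' == y - 1)
  | _, _ => false
  end.

Section Dimers.
Variable R : realType.

(* Index n is used for the torus G_{n+2}, because 'Z_m is Z/mZ only if 2 <= m;
   this does not affect limits in n. *)
Definition tedge (n : nat) : finType := (vertex 'Z_n.+2 * vertex 'Z_n.+2)%type.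

Definition proj_vertex (n : nat) (v : vertex int) : vertex 'Z_n.+2 :=
  (v.1.1%:~R, v.1.2%:~R, v.2).

Definition proj_edge (n : nat) (e : edge int) : tedge n :=
  (proj_vertex n e.1, proj_vertex n e.2).

Definition dimer_coverings (n : nat) : {set {set tedge n}} :=
  [set M : {set tedge n} | [forall e in M, is_edge e] &&
     [forall v, #|[set e in M | (e.1 == v) || (e.2 == v)]| == 1%N]].

Definition dimer_avg (n : nat) (f : {set tedge n} -> R) : R :=
  (\sum_(M in dimer_coverings n) f M) / #|dimer_coverings n|%:R.

Definition occ (n : nat) (e : edge int) (M : {set tedge n}) : R :=
  (proj_edge n e \in M)%:R.

(* The limits exist (the model is gapped), so the default value of limn on
   divergent sequences plays no role. *)
Definition dimer_corr1 (mu : edge int) : R :=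
  limn (fun n => dimer_avg (@occ n mu)).

Definition dimer_corr2 (mu nu : edge int) : R :=
  limn (fun n => dimer_avg (fun M : {set tedge n} => occ mu M * occ nu M)).

Definition Cd (mu nu : edge int) : R :=
  dimer_corr2 mu nu - dimer_corr1 mu * dimer_corr1 nu.

End Dimers.

Section Kasteleyn.
Variable R : realType.

Definition cis (a : R) : R[i] := Complex (cos a) (sin a).

(* Q_{st}(z, w) for s white and t black. *)
Definition Qwb (s t : nat) (z w : R[i]) : R[i] :=
  match s, t with
  | 5%N, 1%N => 2 - w^-1
  | 5%N, 2%N => 1 - z^-1 * w^-1
  | 5%N, 3%N => 1 - 2 * z^-1
  | 5%N, 4%N => - z^-1 - w + 1
  | 6%N, 1%N => z + w - 1
  | 6%N, 2%N => 2 - z^-1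
  | 6%N, 3%N => 1 - w * z^-1
  | 6%N, 4%N => 1 - 2 * w
  | 7%N, 1%N => 2 * z - 1
  | 7%N, 2%N => z + w^-1 - 1
  | 7%N, 3%N => 2 - w
  | 7%N, 4%N => 1 - z * w
  | 8%N, 1%N => 1 - z * w^-1
  | 8%N, 2%N => 1 - 2 * w^-1
  | 8%N, 3%N => - z^-1 - w^-1 + 1
  | 8%N, 4%N => z - 2
  | _, _ => 0
  end.

Definition Q (s t : 'I_8) (z w : R[i]) : R[i] :=
  if black s then - Qwb (vtype t) (vtype s) z^-1 w^-1
  else Qwb (vtype s) (vtype t) z w.

Definition int2pi (f : R -> R) : R :=
  \int[lebesgue_measure]_(k in `[0, 2 * pi]%classic) (f k / (2 * pi)).

(* Integral of a complex-valued function, componentwise. *)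
Definition cint2pi (f : R -> R[i]) : R[i] :=
  Complex (int2pi (fun k => complex.Re (f k)))
          (int2pi (fun k => complex.Im (f k))).

(* Kinv0 s t x y is the matrix element < 0, 0, s | K^-1 | x, y, t >. *)
Definition Kinv0 (s t : 'I_8) (x y : int) : R[i] :=
  if black s == black t then 0 else
  cint2pi (fun kx => cint2pi (fun ky =>
    Q s t (cis kx) (cis ky) * cis (- (kx * x%:~R + ky * y%:~R))
    / Complex (- 5 + 2 * cos kx + 2 * cos ky) 0)).

Definition Kinv (u v : vertex int) : R[i] :=
  Kinv0 u.2 v.2 (v.1.1 - u.1.1) (v.1.2 - u.1.2).

Definition alpha : R := (3 - Num.sqrt 5) / 2.

Definition xi0 : R := (- ln alpha)^-1.

End Kasteleyn.

(* max(|x|, |y|) for the displacement (x, y) between the cells of u and v. *)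
Definition cell_dist (u v : vertex int) : int :=
  Num.max `|v.1.1 - u.1.1| `|v.1.2 - u.1.2|.

Definition endpoint (e : edge int) (v : vertex int) : Prop :=
  v = e.1 \/ v = e.2.

(* Main.v *)
Require Import Defs.
From mathcomp Require Import all_boot all_order all_algebra.
From mathcomp Require Import all_classical all_reals all_analysis.
From mathcomp Require Import complex.
From mathcomp Require Import ring lra zify.

(** Every Q_st is a Laurent polynomial with exponents in {-1, 0, 1}, so the
    matrix elements of K^-1 are combinations of at most three values of the
    massive lattice Green function G(m, n), the Fourier coefficient of
    1 / (5 - 2 cos a - 2 cos b). It is bounded and, away from the origin,
    satisfies 5 G(m, n) = G(m+1, n) + G(m-1, n) + G(m, n+1) + G(m, n-1). Hence
    s_m = sup_n |G(m, n)| satisfies 3 s_m <= s_(m+1) + s_(m-1) for m > 0; as the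
    roots of r^2 - 3 r + 1 are alpha < 1 and 1 / alpha > 1, boundedness forces
    s_(m+1) <= alpha s_m. The same holds in n, which gives the decay even with
    eps = 0. The correlator of e_0 and e_l is a product of two matrix elements
    at cell distance at least l / 2 - c, hence O(alpha^l). *)

Set Implicit Arguments.
Unset Strict Implicit.
Unset Printing Implicit Defensive.

Import Order.TTheory GRing.Theory Num.Theory.
Import numFieldNormedType.Exports.

Local Open Scope ring_scope.

(** * Averages over one period of continuous functions *)

Section Int2pi.
Variable R : realType.
Local Notation mu := (@lebesgue_measure R).
Local Notation I2 := (`[0, 2 * pi]%classic : set R).

Lemma continuous_integrable_2pi (f : R -> R) : continuous f ->
  mu.-integrable I2 (EFin \o f).
Proof.
move=> cf; apply: continuous_compact_integrable; first exact: segment_compact.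
exact: continuous_subspaceT.
Qed.

Lemma int2piE (f : R -> R) : continuous f ->
  int2pi f = (\int[mu]_(k in I2) f k) / (2 * pi).
Proof.
move=> cf; rewrite /int2pi RintegralZr//.
exact: continuous_integrable_2pi.
Qed.

Lemma int2piD (f g : R -> R) : continuous f -> continuous g ->
  int2pi (fun k => f k + g k) = int2pi f + int2pi g.
Proof.
move=> cf cg; rewrite !int2piE//; last by move=> x; apply: cvgD; [exact: cf|exact: cg].
by rewrite -mulrDl RintegralD//; apply: continuous_integrable_2pi.
Qed.

Lemma int2piZ (c : R) (f : R -> R) : continuous f ->
  int2pi (fun k => c * f k) = c * int2pi f.
Proof.
move=> cf; rewrite !int2piE//; last by move=> x; apply: cvgM; [exact: cvg_cst|exact: cf].
by rewrite RintegralZl ?mulrA//; apply: continuous_integrable_2pi.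
Qed.

Lemma int2pi_cst (c : R) : int2pi (fun=> c) = c.
Proof.
rewrite int2piE; last exact: cst_continuous.
rewrite Rintegral_cst//= lebesgue_measure_itv/= lte_fin mulr_gt0 ?pi_gt0//=.
by rewrite subr0 mulfK// mulf_neq0 ?gt_eqF ?pi_gt0.
Qed.

Lemma int2pi_norm_le (M : R) (f : R -> R) : continuous f ->
  (forall k, `|f k| <= M) -> `|int2pi f| <= M.
Proof.
move=> cf fM; rewrite -[leRHS]int2pi_cst !int2piE//; last exact: cst_continuous.
have p0 : 0 < (2 * pi)^-1 :> R by rewrite invr_gt0 mulr_gt0 ?pi_gt0.
rewrite normrM (gtr0_norm p0) ler_pM2r//.
apply: le_trans (le_normr_Rintegral _ _) _ => //.
  exact: continuous_integrable_2pi.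
apply: le_Rintegral => //.
- apply: continuous_integrable_2pi => x.
  by apply: (@cvg_norm _ R^o); exact: cf.
- apply: continuous_integrable_2pi; exact: cst_continuous.
Qed.

Lemma sin_period_int (n : int) (a : R) : sin (2 * pi * n%:~R + a) = sin a.
Proof.
have sn (m : nat) (b : R) : sin (b + 2 * pi * m%:R) = sin b.
  by rewrite mulr_natl mulr_natr (periodicn (@sinD2pi R)).
rewrite addrC; case: n => m; first exact: sn.
by rewrite NegzE -(sn m.+1) rmorphN mulrN subrK.
Qed.

(** The antiderivative [sin (k * n + phi) / n] takes the same value at [0] and at [2 * pi] by
    periodicity. *)
Lemma int2pi_cos (n : int) (phi : R) : n != 0 ->
  int2pi (fun k => cos (k * n%:~R + phi)) = 0.
Proof.
move=> n0.
have nR : n%:~R != 0 :> R by rewrite intr_eq0.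
have ck (g : R -> R) : continuous g -> continuous (fun k : R => g (k * n%:~R + phi)).
  move=> cg x; apply: continuous_comp; last exact: cg.
  by apply: cvgD; [apply: cvgM; [exact: cvg_id|exact: cvg_cst]|exact: cvg_cst].
rewrite int2piE; last exact: (ck _ (@continuous_cos R)).
pose F (k : R) := sin (k * n%:~R + phi) / n%:~R.
have dF (x : R) : is_derive x 1 F (cos (x * n%:~R + phi)).
  rewrite /F; apply: is_derive_eq.
  by rewrite /GRing.scale/=; field.
have cF : continuous F.
  move=> x; apply: differentiable_continuous; apply/derivable1_diffP.
  by have [] := dF x.
rewrite /Rintegral (@continuous_FTC2 _ _ F) /=.
- by rewrite /F sin_period_int mul0r add0r subrr mul0r.
- by rewrite mulr_gt0 ?pi_gt0.
- by apply: continuous_subspaceT; exact: (ck _ (@continuous_cos R)).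
- split; first by move=> x _; have [] := dF x.
  + by apply: cvg_at_right_filter; exact: cF.
  + by apply: cvg_at_left_filter; exact: cF.
- by move=> x _; rewrite derive1E; have [] := dF x.
Qed.
End Int2pi.

(** * Iterated averages of bounded continuous functions, and orthogonality of waves *)

Section DoubleIntegral.
Variable R : realType.
Local Notation mu := (@lebesgue_measure R).
Implicit Types f g : R -> R -> R.

Definition jointly_continuous f := continuous (fun p : R * R => f p.1 p.2).

Definition bounded2 f := exists M : R, forall a b, `|f a b| <= M.

(** A class closed under sums and products on which both iterated integrals are well behaved: a
    uniform bound is itself an integrable dominating function on a compact interval. *)
Definition bcont f := jointly_continuous f /\ bounded2 f.

Definition dint f : R := int2pi (fun a => int2pi (f a)).

Lemma jointly_continuous_r f a : jointly_continuous f -> continuous (f a).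
Proof.
move=> cf b.
apply: (@continuous_comp _ _ _ (fun b : R => (a, b)) (fun p : R * R => f p.1 p.2)).
  by apply: (@cvg_pair _ _ _ _ (nbhs a) (nbhs b)); [exact: cvg_cst|exact: cvg_id].
exact: cf.
Qed.

Lemma jointly_continuous_l f b : jointly_continuous f -> continuous (f ^~ b).
Proof.
move=> cf a.
apply: (@continuous_comp _ _ _ (fun a : R => (a, b)) (fun p : R * R => f p.1 p.2)).
  by apply: (@cvg_pair _ _ _ _ (nbhs a) (nbhs b)); [exact: cvg_id|exact: cvg_cst].
exact: cf.
Qed.

(** Dominated convergence with the constant bound [M]. It makes the inner integral a continuous
    integrand for the outer one, so linearity passes through both. *)
Lemma bcont_int2pi_continuous f : bcont f -> continuous (fun a => int2pi (f a)).
Proof.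
move=> [cf [M fM]].
have -> : (fun a => int2pi (f a)) =
    (fun a => (\int[mu]_(k in `[0, 2 * pi]%classic) f a k) / (2 * pi)).
  by apply/funext => a; rewrite int2piE//; exact: jointly_continuous_r.
move=> x; apply: cvgM; last exact: cvg_cst.
have xI : x \in `](x - 1), (x + 1)[%classic.
  by rewrite inE/= in_itv/= ltrBlDr !ltrDl ltr01.
apply: (@continuity_under_integral R _ _ mu f _ _ (x - 1) (x + 1) _ _ (fun=> M)) xI.
- by [].
- by move=> a _; apply: continuous_integrable_2pi; exact: jointly_continuous_r.
- by apply: aeW => b _ a _; exact: jointly_continuous_l.
- by apply: continuous_integrable_2pi; exact: cst_continuous.
- by move=> a _; apply: aeW => b _; exact: fM.
Qed.

Lemma bcont_continuous_r f a : bcont f -> continuous (f a).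
Proof. by case=> cf _; exact: jointly_continuous_r. Qed.

Lemma bcontD f g : bcont f -> bcont g -> bcont (fun a b => f a b + g a b).
Proof.
move=> [cf [M fM]] [cg [N gN]]; split.
  by move=> p; apply: cvgD; [exact: cf|exact: cg].
by exists (M + N) => a b; rewrite (le_trans (ler_normD _ _))// lerD.
Qed.

Lemma bcontM f g : bcont f -> bcont g -> bcont (fun a b => f a b * g a b).
Proof.
move=> [cf [M fM]] [cg [N gN]]; split.
  by move=> p; apply: cvgM; [exact: cf|exact: cg].
by exists (M * N) => a b; rewrite normrM ler_pM.
Qed.

Lemma bcont_cst (c : R) : bcont (fun _ _ => c).
Proof. by split; [move=> p; exact: cvg_cst|exists `|c|]. Qed.

Lemma bcont_sum I (r : seq I) (f : I -> R -> R -> R) :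
  (forall i, bcont (f i)) -> bcont (fun a b => \sum_(i <- r) f i a b).
Proof.
move=> nf; elim: r => [|i r IH].
  rewrite (_ : (fun _ _ => _) = (fun _ _ => 0)); first exact: bcont_cst.
  by apply/funext => a; apply/funext => b; rewrite big_nil.
rewrite (_ : (fun _ _ => _) = (fun a b => f i a b + \sum_(j <- r) f j a b)).
  exact: bcontD.
by apply/funext => a; apply/funext => b; rewrite big_cons.
Qed.

Lemma dintD f g : bcont f -> bcont g ->
  dint (fun a b => f a b + g a b) = dint f + dint g.
Proof.
move=> nf ng; rewrite /dint -int2piD; try exact: bcont_int2pi_continuous.
by congr int2pi; apply/funext => a; rewrite int2piD//; exact: bcont_continuous_r.
Qed.

Lemma dintZ (c : R) f : bcont f -> dint (fun a b => c * f a b) = c * dint f.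
Proof.
move=> nf; rewrite /dint -int2piZ; try exact: bcont_int2pi_continuous.
by congr int2pi; apply/funext => a; rewrite int2piZ//; exact: bcont_continuous_r.
Qed.

Lemma dint_cst (c : R) : dint (fun _ _ => c) = c.
Proof. by rewrite /dint !int2pi_cst. Qed.

Lemma dint_sum I (r : seq I) (f : I -> R -> R -> R) :
  (forall i, bcont (f i)) ->
  dint (fun a b => \sum_(i <- r) f i a b) = \sum_(i <- r) dint (f i).
Proof.
move=> nf; elim: r => [|i r IH].
  rewrite big_nil -[RHS](dint_cst 0); congr dint.
  by apply/funext => a; apply/funext => b; rewrite big_nil.
rewrite big_cons -IH -(dintD (nf i) (bcont_sum r nf)).
by congr dint; apply/funext => a; apply/funext => b; rewrite big_cons.
Qed.

Lemma dint_sum5 f1 f2 f3 f4 f5 :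
  bcont f1 -> bcont f2 -> bcont f3 -> bcont f4 -> bcont f5 ->
  dint (fun a b => f1 a b + f2 a b + f3 a b + f4 a b + f5 a b) =
  dint f1 + dint f2 + dint f3 + dint f4 + dint f5.
Proof.
move=> n1 n2 n3 n4 n5.
have n12 := bcontD n1 n2; have n123 := bcontD n12 n3; have n1234 := bcontD n123 n4.
by rewrite (dintD n1234 n5) (dintD n123 n4) (dintD n12 n3) (dintD n1 n2).
Qed.

Lemma dint_norm_le (M : R) f : bcont f -> (forall a b, `|f a b| <= M) ->
  `|dint f| <= M.
Proof.
move=> nf fM; apply: int2pi_norm_le; first exact: bcont_int2pi_continuous.
by move=> a; apply: int2pi_norm_le => //; exact: bcont_continuous_r.
Qed.

(* A phase phi = - pi / 2 turns the cosine into a sine, so that real and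
   imaginary parts are treated alike. *)
Definition wave (phi : R) (m n : int) (a b : R) : R :=
  cos (a * m%:~R + b * n%:~R + phi).

Lemma bcont_wave phi m n : bcont (wave phi m n).
Proof.
split; last by exists 1 => a b; exact: cos_max.
move=> p; apply: continuous_comp; last exact: continuous_cos.
apply: cvgD; last exact: cvg_cst.
apply: cvgD.
  by apply: cvgM; [exact: cvg_fst|exact: cvg_cst].
by apply: cvgM; [exact: cvg_snd|exact: cvg_cst].
Qed.

(** If [n] is nonzero, the inner integral already vanishes, with [a * m + phi] as its phase.
    Otherwise the inner integrand is constant and the outer integral vanishes. *)
Lemma dint_wave phi m n : (m != 0) || (n != 0) -> dint (wave phi m n) = 0.
Proof.
have [n0|n0 _] := eqVneq n 0.
  rewrite orbF => m0; rewrite /dint.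
  rewrite -[RHS](@int2pi_cos R m phi m0); congr int2pi; apply/funext => a.
  rewrite -[RHS](int2pi_cst (cos (a * m%:~R + phi))); congr int2pi.
  by apply/funext => b; rewrite /wave n0 mulr0 addr0.
rewrite /dint -[RHS](int2pi_cst (0 : R)); congr int2pi; apply/funext => a.
rewrite -(@int2pi_cos R n (a * m%:~R + phi) n0); congr int2pi.
by apply/funext => b; rewrite /wave; congr cos; ring.
Qed.

End DoubleIntegral.

(** * Exponential decay of bounded solutions of the massive equation on a half plane *)

Section MaximumPrinciple.
Variable R : realType.
Local Notation alpha := (alpha R).

Lemma sqrt5_bounds : (2 < Num.sqrt 5 :> R) * (Num.sqrt 5 < 3 :> R).
Proof.
have h : Num.sqrt 5 ^+ 2 = 5 :> R by rewrite sqr_sqrtr.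
have h0 : 0 <= Num.sqrt 5 :> R by exact: sqrtr_ge0.
split; nra.
Qed.

Lemma alpha_bounds : 0 < alpha < 2^-1.
Proof. by have [h1 h2] := sqrt5_bounds; rewrite /Defs.alpha; lra. Qed.

Lemma alpha_gt0 : 0 < alpha. Proof. by have := alpha_bounds; lra. Qed.

Lemma alpha_le1 : alpha <= 1. Proof. by have := alpha_bounds; lra. Qed.

Lemma alpha_root : alpha ^+ 2 = 3 * alpha - 1.
Proof.
have h : Num.sqrt 5 ^+ 2 = 5 :> R by rewrite sqr_sqrtr.
by rewrite /Defs.alpha expr_div_n sqrrB h; field.
Qed.

(** Let [e_k = s (n + k + 1) - alpha * s (n + k)]. Since [3 - alpha] is the other root [1 / alpha],
    the recurrence gives [e_(k+1) >= (3 - alpha) * e_k]. A positive [e_0] would thus make [s]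
    unbounded. *)
Lemma subharmonic_decay (s : nat -> R) (M : R) :
  (forall n, 0 <= s n <= M) ->
  (forall n, 3 * s n.+1 <= s n.+2 + s n) ->
  forall n, s n.+1 <= alpha * s n.
Proof.
move=> sM ss n; rewrite leNgt; apply/negP => snlt.
pose d := s n.+1 - alpha * s n.
have d0 : 0 < d by rewrite subr_gt0.
have a0 := alpha_gt0; have a2 := alpha_root; have [_ ah] := andP alpha_bounds.
(* Growth is in fact geometric with ratio above 2, but a linear lower bound already contradicts
   boundedness. *)
have grow k : d * k.+1%:R <= s (n + k).+1 - alpha * s (n + k)%N.
  elim: k => [|k IH]; first by rewrite addn0 mulr1.
  have h := ss (n + k)%N; rewrite addnS.
  have h3 : (3 - alpha) * alpha = 1 by rewrite mulrBl -expr2 a2; lra.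
  have : (3 - alpha) * (s (n + k).+1 - alpha * s (n + k)%N) <=
      s (n + k).+2 - alpha * s (n + k).+1.
    rewrite mulrBr mulrA h3 mul1r; nra.
  have k0 : 1 <= k.+1%:R :> R by rewrite ler1n.
  have dk : d <= d * k.+1%:R by rewrite ler_peMr// ltW.
  set e := s (n + k).+1 - _ in IH *; move=> h4.
  have e0 : 0 <= e by rewrite (le_trans _ IH)// mulr_ge0// ltW.
  have h5 : 2 * e <= (3 - alpha) * e by rewrite ler_wpM2r//; lra.
  by rewrite -(natr1 k.+1) mulrDr mulr1; lra.
have M0 : 0 <= M by have /andP[h1 h2] := sM 0%N; exact: le_trans h2.
have := @archi_boundP R (M / d) _; rewrite divr_ge0// ?ltW// => /(_ isT).
set k := Num.bound _; rewrite ltr_pdivrMr// => Mk.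
have := grow k; have /andP[h1 h2] := sM (n + k)%N; have /andP[h3 h4] := sM (n + k).+1.
by rewrite -natr1; nra.
Qed.

Lemma geometric_decay (s : nat -> R) (M : R) :
  (forall n, 0 <= s n <= M) ->
  (forall n, 3 * s n.+1 <= s n.+2 + s n) ->
  forall n, s n <= M * alpha ^+ n.
Proof.
move=> sM ss; elim=> [|n IH]; first by rewrite mulr1; have /andP[] := sM 0%N.
apply: le_trans (subharmonic_decay sM ss n) _.
by rewrite exprS mulrCA ler_pM2l// alpha_gt0.
Qed.

Lemma half_plane_decay (u : nat -> int -> R) (M : R) :
  (forall n y, `|u n y| <= M) ->
  (forall n y, 5 * u n.+1 y =
     u n.+2 y + u n y + u n.+1 (y + 1) + u n.+1 (y - 1)) ->
  forall n y, `|u n y| <= M * alpha ^+ n.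
Proof.
move=> uM harm n y.
pose s n := sup (range (fun y => `|u n y|)).
have sup_ok k : has_sup (range (fun y => `|u k y|)).
  by split; [exists `|u k 0|; exists 0|exists M => _ [z _ <-]].
have us k z : `|u k z| <= s k.
  by apply: sup_upper_bound; [exact: sup_ok|exists z].
have sle k B : (forall z, `|u k z| <= B) -> s k <= B.
  by move=> h; apply: ge_sup; [exact: (sup_ok k).1|move=> _ [z _ <-]].
apply: le_trans (us n y) _; apply: geometric_decay => k.
  by rewrite sle// andbT (le_trans _ (us k 0)).
(* The two neighbours in the same column [k.+1] are each at most [s k.+1]; moving them to the left
   turns the coefficient 5 into 3. *)
have : s k.+1 <= (s k.+2 + s k + 2 * s k.+1) / 5.
  apply: sle => z; rewrite ler_pdivlMr// mulrC -[5]gtr0_norm// -normrM harm.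
  apply: le_trans (ler_normD _ _) _.
  have := ler_normD (u k.+2 z + u k z) (u k.+1 (z + 1)).
  have := ler_normD (u k.+2 z) (u k z).
  have := us k.+2 z; have := us k z; have := us k.+1 (z + 1).
  have := us k.+1 (z - 1); lra.
lra.
Qed.

End MaximumPrinciple.

(** * The massive lattice Green function and its decay in both directions *)

Section Green.
Variable R : realType.
Local Notation alpha := (alpha R).

Definition gap (a b : R) : R := 5 - 2 * cos a - 2 * cos b.

Lemma gap_ge1 a b : 1 <= gap a b.
Proof. by rewrite /gap; have := cos_le1 a; have := cos_le1 b; lra. Qed.

Lemma gap_gt0 a b : 0 < gap a b.
Proof. exact: lt_le_trans (gap_ge1 a b). Qed.

Lemma gapV_le1 a b : `|(gap a b)^-1| <= 1.
Proof. by rewrite gtr0_norm ?invr_gt0 ?gap_gt0// invf_le1 ?gap_gt0 ?gap_ge1. Qed.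

Lemma bcont_gapV : bcont (fun a b => (gap a b)^-1).
Proof.
split; last by exists 1 => a b; exact: gapV_le1.
move=> p; apply: cvgV; first by rewrite gt_eqF ?gap_gt0.
apply: cvgB.
  apply: cvgB; first exact: cvg_cst.
  apply: cvgM; first exact: cvg_cst.
  by apply: continuous_comp; [exact: cvg_fst|exact: continuous_cos].
apply: cvgM; first exact: cvg_cst.
by apply: continuous_comp; [exact: cvg_snd|exact: continuous_cos].
Qed.

Definition green (phi : R) (m n : int) : R :=
  dint (fun a b => wave phi m n a b / gap a b).

Lemma bcont_green phi m n : bcont (fun a b => wave phi m n a b / gap a b).
Proof. exact: (bcontM (bcont_wave phi m n) bcont_gapV). Qed.

Lemma green_le1 phi m n : `|green phi m n| <= 1.
Proof.
apply: dint_norm_le; first exact: bcont_green.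
move=> a b; rewrite normrM -[leRHS]mulr1.
by rewrite ler_pM//; [exact: cos_max|exact: gapV_le1].
Qed.

Lemma cos_addsub (a t : R) : cos (t + a) + cos (t - a) = 2 * cos a * cos t.
Proof. by rewrite cosD cosB; ring. Qed.

(** By the addition formulas, 5 times a wave minus its four neighbours is [gap] times the wave.
    After division by [gap] a pure wave remains, and it integrates to zero away from the origin. *)
Lemma green_harmonic phi m n : (m != 0) || (n != 0) ->
  5 * green phi m n = green phi (m + 1) n + green phi (m - 1) n +
                      green phi m (n + 1) + green phi m (n - 1).
Proof.
move=> mn; have ng := bcont_green phi.
(* The vanishing integral of the wave enters as a fifth summand, so that the two integrands agree
   pointwise. *)
rewrite {1}/green -(dintZ _ (ng _ _)) -[RHS]addr0 -(dint_wave phi mn).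
rewrite /green -(dint_sum5 (ng _ _) (ng _ _) (ng _ _) (ng _ _) (bcont_wave _ _ _)).
congr dint; apply/funext => a; apply/funext => b.
have wm : wave phi (m + 1) n a b + wave phi (m - 1) n a b =
    2 * cos a * wave phi m n a b.
  rewrite -cos_addsub /wave; congr (cos _ + cos _).
    by rewrite rmorphD/=; ring.
  by rewrite rmorphB/=; ring.
have wn : wave phi m (n + 1) a b + wave phi m (n - 1) a b =
    2 * cos b * wave phi m n a b.
  rewrite -cos_addsub /wave; congr (cos _ + cos _).
    by rewrite rmorphD/=; ring.
  by rewrite rmorphB/=; ring.
rewrite -!mulrDl -addrA wn wm.
have := gap_gt0 a b; rewrite /gap => /lt0r_neq0 h.
by field.
Qed.

Lemma green_opp phi m n : green phi (- m) (- n) = green (- phi) m n.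
Proof.
congr dint; apply/funext => a; apply/funext => b; congr (_ / _).
by rewrite /wave -cosN !rmorphN/=; congr cos; ring.
Qed.

(** The half plane [m >= 0] needs the equation only at [m > 0], where the source at the origin is
    absent. Reflection through the origin covers negative [m]; it flips the sign of the phase, so
    the first case is proved for every phase. *)
Lemma green_decay_l phi m n : `|green phi m n| <= alpha ^+ `|m|%N.
Proof.
have pos psi y k : `|green psi (Posz k) y| <= alpha ^+ k.
  rewrite -[leRHS]mul1r.
  apply: (half_plane_decay (u := fun k y => green psi (Posz k) y)).
    by move=> *; exact: green_le1.
  move=> j z; rewrite (@green_harmonic psi (Posz j.+1) z isT).
  have -> : Posz j.+1 + 1 = Posz j.+2 by rewrite -PoszD addn1.
  by have -> : Posz j.+1 - 1 = Posz j by rewrite -addn1 PoszD addrK.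
case: m => k; first exact: pos.
by rewrite NegzE -[n]opprK green_opp pos.
Qed.

Lemma green_decay_r phi m n : `|green phi m n| <= alpha ^+ `|n|%N.
Proof.
have pos psi y k : `|green psi y (Posz k)| <= alpha ^+ k.
  rewrite -[leRHS]mul1r.
  apply: (half_plane_decay (u := fun k y => green psi y (Posz k))).
    by move=> *; exact: green_le1.
  move=> j z; rewrite (@green_harmonic psi z (Posz j.+1) (orbT _)).
  have -> : Posz j.+1 + 1 = Posz j.+2 by rewrite -PoszD addn1.
  have -> : Posz j.+1 - 1 = Posz j by rewrite -addn1 PoszD addrK.
  by rewrite /= -[LHS]addrA [LHS]addrC [LHS]addrA.
case: n => k; first exact: pos.
by rewrite NegzE -[m]opprK green_opp pos.
Qed.

Lemma green_decay phi m n :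
  `|green phi m n| <= alpha ^+ maxn `|m|%N `|n|%N.
Proof.
by rewrite /maxn; case: ltnP => _; [exact: green_decay_r|exact: green_decay_l].
Qed.
End Green.

(** * From the Green function to the inverse Kasteleyn matrix *)

Section KinvDecay.
Variable R : realType.
Local Notation alpha := (alpha R).
Local Open Scope complex_scope.

Lemma cisD (a b : R) : cis (a + b) = cis a * cis b.
Proof.
rewrite /cis cosD sinD; apply/eqP; rewrite eq_complex/= eqxx/=.
by apply/eqP; rewrite addrC.
Qed.

Lemma cis0 : cis 0 = 1 :> R[i].
Proof. by rewrite /cis cos0 sin0. Qed.

Lemma cis_inv (a : R) : (cis a)^-1 = cis (- a).
Proof. by apply/mulr1_eq; rewrite -cisD subrr cis0. Qed.

(* (c, (p, q)) stands for the monomial c z^p w^q. *)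
Definition Qwb_terms (s t : nat) : seq (R * (int * int)) :=
  match s, t with
  | 5%N, 1%N => [:: (2, (0, 0)); (-1, (0, -1))]
  | 5%N, 2%N => [:: (1, (0, 0)); (-1, (-1, -1))]
  | 5%N, 3%N => [:: (1, (0, 0)); (-2, (-1, 0))]
  | 5%N, 4%N => [:: (-1, (-1, 0)); (-1, (0, 1)); (1, (0, 0))]
  | 6%N, 1%N => [:: (1, (1, 0)); (1, (0, 1)); (-1, (0, 0))]
  | 6%N, 2%N => [:: (2, (0, 0)); (-1, (-1, 0))]
  | 6%N, 3%N => [:: (1, (0, 0)); (-1, (-1, 1))]
  | 6%N, 4%N => [:: (1, (0, 0)); (-2, (0, 1))]
  | 7%N, 1%N => [:: (2, (1, 0)); (-1, (0, 0))]
  | 7%N, 2%N => [:: (1, (1, 0)); (1, (0, -1)); (-1, (0, 0))]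
  | 7%N, 3%N => [:: (2, (0, 0)); (-1, (0, 1))]
  | 7%N, 4%N => [:: (1, (0, 0)); (-1, (1, 1))]
  | 8%N, 1%N => [:: (1, (0, 0)); (-1, (1, -1))]
  | 8%N, 2%N => [:: (1, (0, 0)); (-2, (0, -1))]
  | 8%N, 3%N => [:: (-1, (-1, 0)); (-1, (0, -1)); (1, (0, 0))]
  | 8%N, 4%N => [:: (1, (1, 0)); (-2, (0, 0))]
  | _, _ => [::]
  end.

Definition unit_exponents (e : R * (int * int)) : bool :=
  (`|e.2.1| <= 1)%N && (`|e.2.2| <= 1)%N.

Lemma Qwb_terms_unit s t : all unit_exponents (Qwb_terms s t).
Proof.
by case: s => [|[|[|[|[|[|[|[|[|s]]]]]]]]]; case: t => [|[|[|[|[|t]]]]].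
Qed.

Lemma Qwb_terms_weight s t : \sum_(e <- Qwb_terms s t) `|e.1| <= 3.
Proof.
have h1 : `|-1| = 1 :> R by rewrite normrN1.
have h2 : `|-2| = 2 :> R by rewrite normrN ger0_norm.
have h3 : `|2| = 2 :> R by rewrite ger0_norm.
case: s => [|[|[|[|[|[|[|[|[|s]]]]]]]]]; case: t => [|[|[|[|[|t]]]]];
  rewrite /= ?big_cons ?big_nil /= ?h1 ?h2 ?h3 ?normr1; lra.
Qed.

Lemma QwbE s t (a b : R) : Qwb s t (cis a) (cis b) =
  \sum_(e <- Qwb_terms s t) e.1%:C * cis (a * e.2.1%:~R + b * e.2.2%:~R).
Proof.
have c1 (x : R) : x * 1%:~R = x by rewrite mulr1.
have c0 (x : R) : x * 0%:~R = 0 by rewrite mulr0.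
have cN (x : R) : x * (-1)%:~R = - x by rewrite rmorphN mulrN1.
have e1 : (-1)%:C = -1 :> R[i] by rewrite rmorphN rmorph1.
have e2 : 2%:C = 2 :> R[i] by rewrite rmorph_nat.
have e3 : (-2)%:C = -2 :> R[i] by rewrite rmorphN rmorph_nat.
have e4 : 1%:C = 1 :> R[i] by rewrite rmorph1.
case: s => [|[|[|[|[|[|[|[|[|s]]]]]]]]]; case: t => [|[|[|[|[|t]]]]];
  rewrite /= ?big_cons ?big_nil //= ?c0 ?c1 ?cN ?addr0 ?add0r ?cisD -?cis_inv;
  rewrite ?cis0 ?e1 ?e2 ?e3 ?e4; ring.
Qed.

(** Swapping the colours negates all coefficients and exponents, which preserves both the exponent
    bound and the total weight. *)
Lemma Q_expansion (s t : 'I_8) : exists L : seq (R * (int * int)),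
  [/\ all unit_exponents L, \sum_(e <- L) `|e.1| <= 3 &
      forall a b : R, Q s t (cis a) (cis b) =
        \sum_(e <- L) e.1%:C * cis (a * e.2.1%:~R + b * e.2.2%:~R)].
Proof.
rewrite /Q; case: (black s); last first.
  by exists (Qwb_terms (vtype s) (vtype t)); split;
    [exact: Qwb_terms_unit|exact: Qwb_terms_weight|exact: QwbE].
exists [seq (- e.1, (- e.2.1, - e.2.2)) | e <- Qwb_terms (vtype t) (vtype s)].
split.
- rewrite all_map; apply: sub_all (Qwb_terms_unit (vtype t) (vtype s)) => e.
  by rewrite /unit_exponents/= !abszN.
- rewrite big_map; under eq_bigr do rewrite normrN.
  exact: Qwb_terms_weight.
- move=> a b; rewrite big_map !cis_inv QwbE -sumrN; apply: eq_bigr => e _ /=.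
  by rewrite !rmorphN/= mulNr !mulrN !mulNr.
Qed.

Lemma exponent_shift (e : R * (int * int)) (x y : int) : unit_exponents e ->
  (maxn `|x| `|y| <= (maxn `|e.2.1 - x| `|e.2.2 - y|).+1)%N.
Proof. rewrite /unit_exponents => /andP[]; lia. Qed.

(** Each monomial moves the displacement by at most one in the max norm, which costs a factor
    [1 / alpha]; the weights contribute the factor 3. *)
Lemma dint_expansion_decay (L : seq (R * (int * int))) (phi : R) (x y : int)
    (F : R -> R -> R) :
  all unit_exponents L -> \sum_(e <- L) `|e.1| <= 3 ->
  (forall a b, F a b = \sum_(e <- L)
     (- e.1) * (wave phi (e.2.1 - x) (e.2.2 - y) a b / gap a b)) ->
  `|dint F| <= 3 / alpha * alpha ^+ maxn `|x| `|y|.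
Proof.
move=> /allP Lu L3 FE.
have a0 := alpha_gt0 R.
have -> : F = fun a b => \sum_(e <- L)
    (- e.1) * (wave phi (e.2.1 - x) (e.2.2 - y) a b / gap a b).
  by apply/funext => a; apply/funext => b.
pose f (e : R * (int * int)) (a b : R) :=
  (- e.1) * (wave phi (e.2.1 - x) (e.2.2 - y) a b / gap a b).
have nf e : bcont (f e) by exact: bcontM (bcont_cst _) (bcont_green _ _ _).
rewrite (dint_sum L nf); apply: le_trans (ler_norm_sum _ _ _) _.
have fle e : e \in L ->
    `|dint (f e)| <= `|e.1| * (alpha ^+ maxn `|x| `|y| / alpha).
  move=> /Lu ue; rewrite (dintZ _ (bcont_green _ _ _)) normrM normrN.
  rewrite ler_wpM2l//; apply: le_trans (green_decay _ _ _) _.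
  rewrite ler_pdivlMr// -exprSr; apply: ler_wiXn2l (exponent_shift x y ue).
    exact: ltW.
  exact: alpha_le1.
rewrite big_seq; apply: le_trans (ler_sum _ fle) _.
rewrite -big_seq -mulr_suml.
rewrite [leRHS](_ : _ = 3 * (alpha ^+ maxn `|x| `|y| / alpha)); last by ring.
by apply: ler_wpM2r => //; rewrite divr_ge0// ?exprn_ge0// ltW.
Qed.

Lemma normc_le_sum (u v : R) : Normc.normc (Complex u v) <= `|u| + `|v|.
Proof.
rewrite /Normc.normc -(ger0_norm (addr_ge0 (normr_ge0 u) (normr_ge0 v))).
rewrite -sqrtr_sqr ler_wsqrtr// sqrrD !real_normK ?num_real//.
by rewrite addrAC lerDl mulrn_wge0// mulr_ge0.
Qed.

Lemma Kinv0_decay (s t : 'I_8) (x y : int) :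
  Normc.normc (Kinv0 R s t x y) <= 6 / alpha * alpha ^+ maxn `|x| `|y|.
Proof.
have a0 := ltW (alpha_gt0 R).
rewrite /Kinv0; case: ifP => _.
  by rewrite Normc.normc0; apply: mulr_ge0; [exact: divr_ge0|exact: exprn_ge0].
have [L [Lu L3 QE]] := Q_expansion s t.
have FE a b : Q s t (cis a) (cis b) * cis (- (a * x%:~R + b * y%:~R)) /
    Complex (- 5 + 2 * cos a + 2 * cos b) 0 =
    \sum_(e <- L) (- e.1 / gap a b)%:C *
      cis (a * (e.2.1 - x)%:~R + b * (e.2.2 - y)%:~R).
  (* The denominator is the negative of [gap], whence the sign of the coefficients. *)
  rewrite (_ : Complex _ 0 = - (gap a b)%:C); last first.
    by rewrite -rmorphN /gap; congr Complex; ring.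
  rewrite QE !mulr_suml; apply: eq_bigr => e _.
  rewrite -(mulrA e.1%:C) -cisD rmorphM fmorphV !rmorphN /= invrN !mulrN !mulNr.
  rewrite mulrAC; congr (- (_ * _ * _)); congr cis.
  by rewrite !rmorphB/=; ring.
have -> : (6 / alpha * alpha ^+ maxn `|x| `|y|) =
    3 / alpha * alpha ^+ maxn `|x| `|y| + 3 / alpha * alpha ^+ maxn `|x| `|y| by ring.
(* Phase [0] yields the real part and phase [- (pi / 2)] the imaginary part; each contributes 3 to
   the constant 6. *)
apply: le_trans (normc_le_sum _ _) (lerD _ _).
- apply: (dint_expansion_decay (phi := 0) Lu L3) => a b.
  rewrite FE raddf_sum; apply: eq_bigr => e _ /=.
  by rewrite /wave addr0; ring.
- apply: (dint_expansion_decay (phi := - (pi / 2)) Lu L3) => a b.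
  rewrite FE raddf_sum; apply: eq_bigr => e _ /=.
  by rewrite /wave cosBpihalf; ring.
Qed.
End KinvDecay.

(** * Numerical enclosure of the correlation length *)

Section Xi0.
Variable R : realType.
Local Notation alpha := (alpha R).

(* Grouping the exponential series in pairs makes even partial sums lower bounds
   also for negative arguments. *)
Lemma exp_coeff_pair_gt0 (x : R) (k : nat) : -1 < x -> x != 0 ->
  0 < exp_coeff x k.*2 + exp_coeff x k.*2.+1.
Proof.
move=> x1 x0.
have k0 : 0 < (k.*2)`!%:R :> R by rewrite ltr0n fact_gt0.
rewrite /exp_coeff/= factS natrM.
rewrite [ltRHS](_ : _ =
    (x ^+ k) ^+ 2 / (k.*2)`!%:R * ((k.*2.+1%:R + x) / k.*2.+1%:R)); last first.
  rewrite exprSr -exprM muln2; field.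
  by rewrite (gt_eqF k0) andbT nat1r pnatr_eq0.
have k1 : 0 < k.*2.+1%:R + x.
  have : 1 <= k.*2.+1%:R :> R by rewrite ler1n.
  lra.
by rewrite mulr_gt0 ?divr_gt0// exprn_even_gt0//= expf_neq0.
Qed.

(* sum_(i < n) x^i k! / (k + i)! *)
Fixpoint exp_horner (x : R) (k n : nat) : R :=
  if n is n'.+1 then 1 + x / k.+1%:R * exp_horner x k.+1 n' else 0.

(** Consecutive exponential coefficients have ratio [x / k.+1], so peeling off the first term raises
    the offset [k] by one. *)
Lemma exp_horner_sum (x : R) (k n : nat) :
  \sum_(0 <= i < n) exp_coeff x (k + i)%N = exp_coeff x k * exp_horner x k n.
Proof.
elim: n k => [|n IH] k; first by rewrite big_geq// mulr0.
rewrite big_nat_recl// addn0.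
under eq_bigr do rewrite addnS -addSn.
rewrite IH/= mulrDr mulr1 mulrA; congr (_ + _ * _).
rewrite /exp_coeff/= factS natrM invfM exprSr mulrACA.
by rewrite [X in _ * X]mulrC mulrA mulrAC -!mulrA.
Qed.

Lemma expR_gt_horner (x : R) (n : nat) : -1 < x -> x != 0 ->
  exp_horner x 0 n.*2 < expR x.
Proof.
move=> x1 x0.
have := exp_horner_sum x 0 n.*2.
rewrite [X in X * _]/exp_coeff/= expr0 divr1 mul1r => <-.
under eq_bigr do rewrite add0n.
apply: lt_sum_lim_series; first exact: is_cvg_series_exp_coeff.
by move=> d; rewrite addnS -doubleD exp_coeff_pair_gt0.
Qed.

(** Seven decimals suffice: the fractions compared with [- ln alpha] below differ from it by more
    than [10^-7]. *)
Lemma sqrt5_approx :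
  (2 + 236 / 10 ^+ 3 + 679 / 10 ^+ 7 < Num.sqrt 5 :> R) *
  (Num.sqrt 5 < 2 + 236 / 10 ^+ 3 + 680 / 10 ^+ 7 :> R).
Proof.
have h : Num.sqrt 5 ^+ 2 = 5 :> R by rewrite sqr_sqrtr.
have h0 : 0 <= Num.sqrt 5 :> R by exact: sqrtr_ge0.
split; nra.
Qed.

(* In the two evaluations below the innermost value comes first, and each step
   is rounded to nine digits in the direction that matters. *)
Lemma exp_horner_1255_1304 :
  381 / 10 ^+ 3 + 966 / 10 ^+ 6 + 137 / 10 ^+ 9 <= exp_horner (- (1255 / 1304)) 0 12.
Proof.
have h0 (x : R) k : exp_horner x k 0 = 0 by [].
have hS (x : R) k n :
  exp_horner x k n.+1 = 1 + x / k.+1%:R * exp_horner x k.+1 n by [].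
move: exp_horner h0 hS => h h0 hS; move xE: (- (1255 / 1304)) => x.
have b11 : h x 11%N 1%N = 1 by rewrite hS h0 mulr0 addr0.
(* As [x] is negative, every step reverses the inequality, so lower and upper bounds alternate. *)
have {b11} b10 : 912 / 10 ^+ 3 + 506 / 10 ^+ 6 + 971 / 10 ^+ 9 <= h x 10%N 2%N
  by rewrite hS -{1}xE; lra.
have {b10} b9 : h x 9%N 3%N <= 912 / 10 ^+ 3 + 178 / 10 ^+ 6 + 202 / 10 ^+ 9
  by rewrite hS -{1}xE; lra.
have {b9} b8 : 902 / 10 ^+ 3 + 455 / 10 ^+ 6 + 381 / 10 ^+ 9 <= h x 8%N 4%N
  by rewrite hS -{1}xE; lra.
have {b8} b7 : h x 7%N 5%N <= 891 / 10 ^+ 3 + 431 / 10 ^+ 6 + 988 / 10 ^+ 9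
  by rewrite hS -{1}xE; lra.
have {b7} b6 : 877 / 10 ^+ 3 + 437 / 10 ^+ 6 + 867 / 10 ^+ 9 <= h x 6%N 6%N
  by rewrite hS -{1}xE; lra.
have {b6} b5 : h x 5%N 7%N <= 859 / 10 ^+ 3 + 255 / 10 ^+ 6 + 557 / 10 ^+ 9
  by rewrite hS -{1}xE; lra.
have {b5} b4 : 834 / 10 ^+ 3 + 606 / 10 ^+ 6 + 484 / 10 ^+ 9 <= h x 4%N 8%N
  by rewrite hS -{1}xE; lra.
have {b4} b3 : h x 3%N 9%N <= 799 / 10 ^+ 3 + 188 / 10 ^+ 6 + 816 / 10 ^+ 9
  by rewrite hS -{1}xE; lra.
have {b3} b2 : 743 / 10 ^+ 3 + 614 / 10 ^+ 6 + 17 / 10 ^+ 9 <= h x 2%N 10%N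
  by rewrite hS -{1}xE; lra.
have {b2} b1 : h x 1%N 11%N <= 642 / 10 ^+ 3 + 164 / 10 ^+ 6 + 268 / 10 ^+ 9
  by rewrite hS -{1}xE; lra.
by rewrite hS -{1}xE; lra.
Qed.

Lemma exp_horner_2843_2954 :
  2 + 618 / 10 ^+ 3 + 34 / 10 ^+ 6 + 259 / 10 ^+ 9 <= exp_horner (2843 / 2954) 0 10.
Proof.
have h0 (x : R) k : exp_horner x k 0 = 0 by [].
have hS (x : R) k n :
  exp_horner x k n.+1 = 1 + x / k.+1%:R * exp_horner x k.+1 n by [].
move: exp_horner h0 hS => h h0 hS; move xE: (2843 / 2954) => x.
have b9 : h x 9%N 1%N = 1 by rewrite hS h0 mulr0 addr0.
have {b9} b8 : 1 + 106 / 10 ^+ 3 + 935 / 10 ^+ 6 + 981 / 10 ^+ 9 <= h x 8%N 2%N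
  by rewrite hS -{1}xE; lra.
have {b8} b7 : 1 + 133 / 10 ^+ 3 + 167 / 10 ^+ 6 + 696 / 10 ^+ 9 <= h x 7%N 3%N
  by rewrite hS -{1}xE; lra.
have {b7} b6 : 1 + 155 / 10 ^+ 3 + 798 / 10 ^+ 6 + 228 / 10 ^+ 9 <= h x 6%N 4%N
  by rewrite hS -{1}xE; lra.
have {b6} b5 : 1 + 185 / 10 ^+ 3 + 394 / 10 ^+ 6 + 626 / 10 ^+ 9 <= h x 5%N 5%N
  by rewrite hS -{1}xE; lra.
have {b5} b4 : 1 + 228 / 10 ^+ 3 + 170 / 10 ^+ 6 + 407 / 10 ^+ 9 <= h x 4%N 6%N
  by rewrite hS -{1}xE; lra.
have {b4} b3 : 1 + 295 / 10 ^+ 3 + 505 / 10 ^+ 6 + 117 / 10 ^+ 9 <= h x 3%N 7%N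
  by rewrite hS -{1}xE; lra.
have {b3} b2 : 1 + 415 / 10 ^+ 3 + 608 / 10 ^+ 6 + 333 / 10 ^+ 9 <= h x 2%N 8%N
  by rewrite hS -{1}xE; lra.
have {b2} b1 : 1 + 681 / 10 ^+ 3 + 207 / 10 ^+ 6 + 598 / 10 ^+ 9 <= h x 1%N 9%N
  by rewrite hS -{1}xE; lra.
by rewrite hS -{1}xE; lra.
Qed.

(* The two fractions separate - ln alpha = 0.96242365... from the inverses of
   1.039044 and 1.039043. *)
Lemma lnalpha_bounds : 1255 / 1304 < - ln alpha < 2843 / 2954.
Proof.
have a0 := alpha_gt0 R; have a2 := alpha_root R.
have [l u] := sqrt5_approx.
have ai : alpha^-1 = 3 - alpha.
  by apply: mulr1_eq; rewrite mulrBr -expr2 a2; lra.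
apply/andP; split.
- rewrite ltrNr -ltr_expR lnK ?posrE//.
  apply: lt_trans (le_lt_trans exp_horner_1255_1304 (@expR_gt_horner _ 6 _ _));
    [|lra|lra].
  by rewrite /Defs.alpha; lra.
(* Passing to reciprocals turns the claim into [3 - alpha < expR (2843 / 2954)], again a lower bound
   on an exponential. *)
- rewrite ltrNl -ltr_expR lnK ?posrE// expRN invf_plt ?posrE ?expR_gt0// ai.
  apply: lt_trans (le_lt_trans exp_horner_2843_2954 (@expR_gt_horner _ 5 _ _));
    [|lra|lra].
  by rewrite /Defs.alpha; lra.
Qed.

Lemma xi0_bounds :
  1 + 39 / 10 ^+ 3 + 43 / 10 ^+ 6 <= xi0 R < 1 + 39 / 10 ^+ 3 + 44 / 10 ^+ 6.
Proof.
have /andP[l u] := lnalpha_bounds.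
have L0 : 0 < - ln alpha by lra.
have xL : xi0 R * - ln alpha = 1 by rewrite /xi0 mulVf// gt_eqF.
have x0 : 0 < xi0 R by rewrite invr_gt0.
apply/andP; split.
  rewrite -(ler_pM2r L0) xL; lra.
rewrite -(ltr_pM2r L0) xL; lra.
Qed.
End Xi0.

(** * Decay rate of the dimer-dimer correlator *)

Section Correlator.
Variable R : realType.
Local Notation alpha := (alpha R).

Lemma natr_max_absz (x y : int) :
  (Num.max `|x| `|y|)%:~R = (maxn `|x| `|y|)%:R :> R.
Proof. by rewrite -[RHS]/((Posz (maxn `|x| `|y|))%:~R); congr (_%:~R); lia. Qed.

(** Since [alpha <= 1], the exponent may be lowered to any real [r]; this serves both the exponent
    with [1 - eps] and the distance bound [l / 2 - c]. *)
Lemma Kinv0_powR_decay (s t : 'I_8) (x y : int) (r : R) :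
  r <= (Num.max `|x| `|y|)%:~R ->
  Normc.normc (Kinv0 R s t x y) <= 6 / alpha * alpha `^ r.
Proof.
have a0 := alpha_gt0 R; have a1 := alpha_le1 R.
rewrite natr_max_absz => rle; apply: le_trans (Kinv0_decay R _ _ _ _) _.
apply: ler_wpM2l; first by rewrite divr_ge0// ltW.
rewrite -powR_mulrn; last exact: ltW.
by apply: ger_powR => //; apply/andP.
Qed.

Lemma limn_esup_le_near (u : (\bar R)^nat) (v : \bar R) :
  (forall d : R, 0 < d -> exists N, forall n, (N <= n)%N -> (u n <= v + d%:E)%E) ->
  (limn_esup u <= v)%E.
Proof.
move=> h; apply/lee_addgt0Pr => d /h[N hN].
apply: (@le_trans _ _ (ereal_sup (u @` [set n | (N <= n)%N])%classic)).
  by apply: ereal_inf_lbound; exists [set n | (N <= n)%N]%classic => //=; exists N.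
by apply: ge_ereal_sup => _ [n /= Nn <-]; exact: hN.
Qed.

(** The extended logarithm admits [z = 0], with value minus infinity, so a vanishing correlator
    needs no separate treatment. *)
Lemma lne_scaled_le (z B w : R) : 0 <= z -> 0 < B -> z <= B -> 0 <= w ->
  (w%:E * lne z%:E <= (w * ln B)%:E)%E.
Proof.
move=> z0 B0 zB w0; rewrite EFinM -lne_EFin//.
apply: lee_wpmul2l; rewrite ?lee_fin// lee_lne ?lee_fin ?in_itv/= ?lee_fin ?leey ?z0//.
by rewrite andbT ltW.
Qed.

Lemma Cd_rate (e : nat -> edge int) (c : R) :
  (forall mu nu : edge int, is_edge mu -> is_edge nu -> mu <> nu ->
      `|Cd R mu nu| = Normc.normc (Kinv R nu.2 mu.1 * Kinv R mu.2 nu.1)) ->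
  (forall l, is_edge (e l)) ->
  (forall (l : nat) (u v : vertex int),
        endpoint (e 0%N) u -> endpoint (e l) v ->
        l%:R / 2 - c <= (cell_dist u v)%:~R) ->
  forall l : nat, 2 * c < l%:R ->
  `|Cd R (e 0%N) (e l)| <= (6 / alpha) ^+ 2 * alpha `^ (l%:R - 2 * c).
Proof.
move=> CdE ee dist l cl; have a0 := alpha_gt0 R.
(* Equal edges would share an endpoint at distance 0, against [l / 2 - c > 0]. *)
have ne : e 0%N <> e l.
  move=> e0l; have := dist l (e 0%N).1 (e 0%N).1 (or_introl erefl).
  rewrite /endpoint -e0l => /(_ (or_introl erefl)).
  by rewrite /cell_dist !subrr normr0 maxxx/=; lra.
rewrite CdE// Normc.normcM expr2.
rewrite (_ : l%:R - 2 * c = (l%:R / 2 - c) + (l%:R / 2 - c)); last by field.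
rewrite powRD; last by rewrite (gt_eqF a0) implybT.
have n0 z : 0 <= Normc.normc z :> R by case: z => *; exact: sqrtr_ge0.
rewrite mulrACA; apply: ler_pM; [exact: n0|exact: n0| |];
  apply: Kinv0_powR_decay.
(* This matrix element runs from [e l] back to [e 0], so the displacement is reversed. *)
- have := dist l (e 0%N).1 (e l).2 (or_introl erefl) (or_intror erefl).
  by rewrite /cell_dist (distrC _.1.1) (distrC _.1.2).
- exact: dist l (e 0%N).2 (e l).1 (or_intror erefl) (or_introl erefl).
Qed.

End Correlator.

Theorem mainTheorem3 (R : realType) :
  (forall eps : R, 0 < eps ->
     exists C : R, forall (x y : int) (s t : 'I_8),
       Normc.normc (Kinv0 R s t x y)
         <= C * alpha R `^ ((Num.max `|x| `|y|)%:~R * (1 - eps)))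
  /\
  ((forall mu nu : edge int, is_edge mu -> is_edge nu -> mu <> nu ->
      `|Cd R mu nu| = Normc.normc (Kinv R nu.2 mu.1 * Kinv R mu.2 nu.1)) ->
   forall e : nat -> edge int,
     (forall l : nat, is_edge (e l)) ->
     (exists c : R, forall (l : nat) (u v : vertex int),
        endpoint (e 0%N) u -> endpoint (e l) v ->
        l%:R / 2 - c <= (cell_dist u v)%:~R) ->
     (limn_esup (fun l : nat => (l%:R^-1)%:E * lne `|Cd R (e 0%N) (e l)|%:E)
        <= (- (xi0 R)^-1)%:E)%E)
  /\ - (xi0 R)^-1 = ln (alpha R)
  /\ 1 + 39 / 10 ^+ 3 + 43 / 10 ^+ 6 <= xi0 R < 1 + 39 / 10 ^+ 3 + 44 / 10 ^+ 6.
Proof.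
have a0 := alpha_gt0 R.
have xiE : - (xi0 R)^-1 = ln (alpha R) by rewrite /xi0 invrK opprK.
split; last split; [|move=> CdE e ee [c dist]|split => //; exact: xi0_bounds].
  move=> eps eps0; exists (6 / alpha R) => x y s t.
  apply: Kinv0_powR_decay; rewrite ler_piMr ?natr_max_absz//.
  by rewrite gerBl ltW.
rewrite xiE; apply: limn_esup_le_near => d d0.
pose A := (6 / alpha R) ^+ 2.
have A0 : 0 < A by apply: exprn_gt0; exact: divr_gt0.
(* The logarithm of the bound is [l * ln alpha + K], so the error [K / l] falls below [d] once
   [l > |K| / d]. The threshold chosen next also ensures [l > 2 * c] and [l > 0]. *)
pose K := ln A - 2 * c * ln (alpha R).
exists (Num.bound `|2 * c| + Num.bound (`|K| / d)).+1 => l hl.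
have /archi_boundP b1 : 0 <= `|2 * c| by [].
have /archi_boundP b2 : 0 <= `|K| / d by apply: divr_ge0 => //; exact: ltW.
have lc : 2 * c < l%:R.
  apply: le_lt_trans (ler_norm _) (lt_le_trans b1 _).
  by rewrite ler_nat; apply: leq_trans hl; rewrite ltnW// ltnS leq_addr.
have lK : `|K| / d < l%:R.
  apply: lt_le_trans b2 _.
  by rewrite ler_nat; apply: leq_trans hl; rewrite ltnW// ltnS leq_addl.
have l0 : 0 < l%:R :> R by rewrite ltr0n (leq_trans _ hl).
have B0 : 0 < A * alpha R `^ (l%:R - 2 * c) by rewrite mulr_gt0// powR_gt0.
apply: le_trans (lne_scaled_le (normr_ge0 _) B0 (Cd_rate CdE ee dist lc) _) _.
  by rewrite invr_ge0 ltW.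
rewrite -EFinD lee_fin lnM ?posrE ?powR_gt0// ln_powR.
rewrite -(ler_pM2l l0) mulVKf ?gt_eqF//.
have hK : K < d * l%:R.
  rewrite mulrC -ltr_pdivrMr// (le_lt_trans _ lK)//.
  by rewrite ler_pM2r ?invr_gt0// ler_norm.
by rewrite /K in hK; lra.
Qed.
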